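(* Let $d=3$, $\ell=0$, $0<R_1<R_2$. For $(\alpha_1,\alpha_2)$ put $$\alpha_1'=\alpha_2-\frac1{R_1}-\frac1{R_2},\qquad\alpha_2'=\alpha_1+\frac1{R_1}+\frac1{R_2}.$$ Then $(\alpha_1,\alpha_2)$ and $(\alpha_1',\alpha_2')$ have the same $\ell=0$ spectrum, and the map $(\alpha_1,\alpha_2)\mapsto(\alpha_1',\alpha_2')$ is an involution on the impedance plane. The reflected pair $(\alpha_1',\alpha_2')$ is distinct from $(\alpha_1,\alpha_2)$ if and only if $\alpha_2-\alpha_1\neq R_1^{-1}+R_2^{-1}$, and, for $\alpha_1,\alpha_2>0$, it lies in the positive quadrant if and only if $$\alpha_2>\frac1{R_1}+\frac1{R_2}.$$ Consequently, for all $\alpha_1>0$ and $\alpha_2>R_1^{-1}+R_2^{-1}$, except on the line $\alpha_2-\alpha_1=R_1^{-1}+R_2^{-1}$ where the reflected pair coincides with the original one, there is a second pair of positive impedances with the same $\ell=0$ spectrum, so the $\ell=0$ spectrum (and hence any finite collection of $\ell=0$ resonances) cannot identify the impedances. For example, for $R_1=1$, $R_2=2$ the pair $(1,1)$ has reflection partner $(-1/2,5/2)$, while the pair $(2,3)$ has the partner $(3/2,7/2)$ in the positive quadrant.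
   Context: The $\ell=0$ spectrum for impedances $(\alpha_1,\alpha_2)\in\mathbb R^2$ is the set of eigenvalues $\lambda=k^2$ of the radial Robin problem on the spherical shell in $\mathbb R^3$: $$u''+\frac2ru'+\lambda u=0\ \text{ on }(R_1,R_2),\qquad -u'(R_1)+\alpha_1u(R_1)=0,\quad u'(R_2)+\alpha_2u(R_2)=0.$$ *)

(* Defs.v *)
From Stdlib Require Import Reals Lra List.
From Coquelicot Require Import Coquelicot.
Open Scope R_scope.

(* Derivative at [r] of [u] regarded as a function on [a, b] only, so that it
   is the one-sided derivative at the endpoints.  Values are complex, the
   variable is real, hence the explicit real normed-module structure on [C]. *)
Definition is_derive_on (a b : R) (u : R -> C) (r : R) (l : C) : Prop :=
  @filterdiff R_AbsRing R_NormedModule C_R_NormedModule u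
    (within (fun x => a <= x <= b) (locally r))
    (fun h => @scal R_AbsRing C_R_NormedModule h l).

(* [u] is a classical solution: differentiable on [r1, r2] with derivative
   [du], and twice differentiable inside with second derivative [ddu].
   Continuity of [du] up to the boundary then follows from the equation. *)
Definition robin_solution (r1 r2 : R) (alpha : R * R) (lam : C)
    (u : R -> C) : Prop :=
  exists du ddu : R -> C,
    (forall r, r1 <= r <= r2 -> is_derive_on r1 r2 u r (du r)) /\
    (forall r, r1 < r < r2 ->
       @is_derive R_AbsRing C_R_NormedModule du r (ddu r)) /\
    (forall r, r1 < r < r2 ->
       (ddu r + RtoC (2 / r) * du r + lam * u r = 0)%C) /\
    (- du r1 + RtoC (fst alpha) * u r1 = 0)%C /\
    (du r2 + RtoC (snd alpha) * u r2 = 0)%C.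

(* Eigenvalues are sought in [C]; their reality (the problem is self-adjoint)
   is not built in. *)
Definition spectrum (r1 r2 : R) (alpha : R * R) (lam : C) : Prop :=
  exists u : R -> C,
    robin_solution r1 r2 alpha lam u /\
    exists r, r1 <= r <= r2 /\ u r <> RtoC 0.

Definition same_spectrum (r1 r2 : R) (alpha beta : R * R) : Prop :=
  forall lam : C, spectrum r1 r2 alpha lam <-> spectrum r1 r2 beta lam.

(* A resonance is a wave number [k] with [k ^ 2] an eigenvalue. *)
Definition resonance (r1 r2 : R) (alpha : R * R) (k : C) : Prop :=
  spectrum r1 r2 alpha (k * k)%C.

Definition reflect_pair (r1 r2 : R) (alpha : R * R) : R * R :=
  (snd alpha - / r1 - / r2, fst alpha + / r1 + / r2).

Definition positive_quadrant (alpha : R * R) : Prop :=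
  0 < fst alpha /\ 0 < snd alpha.

(* The data determine the impedances among all positive pairs. *)
Definition identified_by_spectrum (r1 r2 : R) (alpha : R * R) : Prop :=
  forall beta, positive_quadrant beta ->
    same_spectrum r1 r2 alpha beta -> beta = alpha.

Definition identified_by_resonances (r1 r2 : R) (alpha : R * R)
    (ks : list C) : Prop :=
  forall beta, positive_quadrant beta ->
    List.Forall (resonance r1 r2 beta) ks -> beta = alpha.

(* Main.v *)
Require Import Defs.
From Stdlib Require Import Reals Lra List.
From Coquelicot Require Import Coquelicot.
Open Scope R_scope.

(** On functions [u], the map of impedances is induced by reflecting [w = r u]
    about the midpoint of the shell: [w] solves [w'' + lam w = 0], which is
    invariant under [r |-> r1 + r2 - r], and the Robin conditions become
    [- w' + (alpha1 + 1 / r1) w = 0] at [r1] and [w' + (alpha2 - 1 / r2) w = 0]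
    at [r2], so the reflection exchanges the two coefficients.  In terms of [u]
    it reads [v r = (r1 + r2 - r) / r * u (r1 + r2 - r)]. *)

(** * Differentials along general filters *)

Lemma filterdiff_filter_le {K : AbsRing} {U V : NormedModule K}
    (F G : (U -> Prop) -> Prop) {FF : ProperFilter F} {FG : ProperFilter G}
    (f l : U -> V) (x : U) :
  filter_le G F -> is_filter_lim F x -> filterdiff f F l -> filterdiff f G l.
Proof.
  intros HGF HF [Hl Hf]; split; [exact Hl|].
  intros y Hy.
  (* The estimate in [filterdiff] is stated at every limit of the filter. Limits of a proper filter
     are unique, so the only limit of the finer [G] is the limit of [F], where [Hf] gives an
     estimate that can be restricted. *)
  assert (E : x = y).
  { apply (is_filter_lim_unique (F := G)); [|exact Hy].
    exact (is_filter_lim_filter_le x HGF HF). }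
  subst y.
  exact (is_domin_le _ _ (Hf x HF) HGF).
Qed.

(** Product rule along a filter: compose the pair of functions with the bilinear [scal]. Its
    differential is needed at the limit of the image filter, which is [(f x, g x)] because
    differentiability along [F] gives continuity along [F]. *)
Lemma filterdiff_scal_fct_lim {K : AbsRing} {U V : NormedModule K}
    (F : (U -> Prop) -> Prop) {FF : ProperFilter F} (x : U)
    (f : U -> K) (g : U -> V) (lf : U -> AbsRing_NormedModule K) (lg : U -> V) :
  (forall n m : K, mult n m = mult m n) -> is_filter_lim F x ->
  filterdiff f F lf -> filterdiff g F lg ->
  filterdiff (fun t => scal (f t) (g t)) F
    (fun t => plus (scal (lf t) (g x)) (scal (f x) (lg t))).
Proof.
  intros HK Hx Hf Hg.
  apply (filterdiff_comp_2 f g scal lf lg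
           (fun k v => plus (scal k (g x)) (scal (f x) v))); try assumption.
  refine (filterdiff_scal (F := filtermap (fun t => (f t, g t)) F)
            (f x, g x) _ HK).
  assert (Cf : filterlim f F (locally (f x)))
    by (apply (filterdiff_continuous_aux f); [exists lf|]; assumption).
  assert (Cg : filterlim g F (locally (g x)))
    by (apply (filterdiff_continuous_aux g); [exists lg|]; assumption).
  intros P [eps HP].
  pose proof (filter_and (F := F) _ _
                (Cf (ball (f x) eps) (locally_ball (f x) eps))
                (Cg (ball (g x) eps) (locally_ball (g x) eps))) as H.
  revert H; apply (filter_imp (F := F)); intros t [H1 H2].
  apply HP; split; assumption.
Qed.

(** Stated for two filters so that it covers both one-sided derivatives at the ends of the shell,
    through [within], and ordinary derivatives inside, through [locally]. *)
Lemma filterdiff_scal_reflect {V : NormedModule R_AbsRing}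
    (F G : (R -> Prop) -> Prop) {FF : ProperFilter F} {FG : ProperFilter G}
    (s r : R) (c : R -> R) (c' : R) (g : R -> V) (l : V) :
  is_filter_lim F r -> is_filter_lim G (s - r) ->
  filterlim (fun t => s - t) F G ->
  is_derive c r c' ->
  filterdiff g G (fun h : R_NormedModule => scal h l) ->
  filterdiff (fun t => scal (c t) (g (s - t))) F
    (fun h : R_NormedModule =>
       scal h (plus (scal c' (g (s - r))) (scal (- c r) l))).
Proof.
  intros Hr Hsr Hlim Hc Hg.
  assert (Hrefl : filterdiff (fun t : R => s - t) F (fun h : R => - h)).
  { apply (filterdiff_locally _ r); [exact Hr|].
    apply (filterdiff_ext_lin _ (fun h : R => scal h (-1))).
    - assert (H : is_derive (fun t : R => s - t) r (-1))
        by (auto_derive; [trivial|ring]).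
      exact H.
    - intros h; unfold scal; simpl; unfold mult; simpl; ring. }
  (* The chain rule asks for the differential of [g] along the image of [F] under the reflection; by
     [Hlim] this image is finer than [G]. *)
  assert (Hgs : filterdiff (fun t => g (s - t)) F (fun h : R => scal (- h) l)).
  { apply (filterdiff_comp (fun t : R => s - t) g (fun h : R => - h)
             (fun h : R => scal h l) Hrefl).
    apply (filterdiff_filter_le G _ g _ (s - r) Hlim Hsr Hg). }
  apply (filterdiff_ext_lin _
           (fun h : R => plus (scal (scal h c') (g (s - r)))
                              (scal (c r) (scal (- h) l)))).
  - apply (filterdiff_scal_fct_lim F r c (fun t => g (s - t))
             (fun h => scal h c') (fun h => scal (- h) l)); try assumption.
    + intros n m; apply Rmult_comm.
    + exact (filterdiff_locally c r _ Hr Hc).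
  - intros h.
    rewrite (scal_distr_l h), !scal_assoc.
    f_equal; f_equal; unfold scal, mult; simpl; unfold mult; simpl; ring.
Qed.

(** * Filters on a closed interval and their reflection *)

Lemma within_Icc_proper (a b x : R) :
  a < b -> a <= x <= b ->
  ProperFilter (within (fun t => a <= t <= b) (locally x)).
Proof.
  intros Hab Hx; split; [|apply within_filter, locally_filter].
  intros P [eps HP]; exists x; apply HP; [apply ball_center|exact Hx].
Qed.

Lemma is_filter_lim_within (D : R -> Prop) (x : R) :
  is_filter_lim (within D (locally x)) x.
Proof. exact (filter_le_within D). Qed.

Lemma filterlim_reflect (s r : R) :
  filterlim (fun t => s - t) (locally r) (locally (s - r)).
Proof.
  apply (continuous_minus (V := R_NormedModule) (fun _ : R => s) (fun t => t));
    [apply continuous_const|apply continuous_id].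
Qed.

Lemma filterlim_reflect_within (a b r : R) :
  filterlim (fun t => a + b - t)
    (within (fun t => a <= t <= b) (locally r))
    (within (fun t => a <= t <= b) (locally (a + b - r))).
Proof.
  intros P HP.
  apply (filterlim_reflect (a + b) r) in HP.
  unfold filtermap, within in *.
  revert HP; apply filter_imp; intros t H Ht; apply H; lra.
Qed.

(** The interval is a neighbourhood of an interior point, so restricting to it changes nothing in
    the limit. *)
Lemma is_derive_on_interior (a b : R) (u : R -> C) (r : R) (l : C) :
  a < r < b -> is_derive_on a b u r l ->
  @is_derive R_AbsRing C_R_NormedModule u r l.
Proof.
  intros Hr Hu.
  assert (Hab : a < b) by lra.
  assert (Hr' : a <= r <= b) by lra.
  pose proof (within_Icc_proper a b r Hab Hr') as HF.
  unfold is_derive.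
  refine (filterdiff_filter_le _ (locally r) u _ r _
            (is_filter_lim_within _ r) Hu).
  intros P HP.
  assert (Hloc : locally r (fun t => a < t < b)) by
    (apply filter_and; [apply (open_gt a)|apply (open_lt b)]; lra).
  generalize (filter_and _ _ Hloc HP); apply filter_imp.
  intros t [Ht H]; apply H; lra.
Qed.

(** * Reflection of solutions and eigenvalues *)

Lemma Cminus_eq_0 (x y : C) : (x - y = 0)%C -> x = y.
Proof.
  intros H; transitivity (x - y + y)%C; [ring|rewrite H; ring].
Qed.

Ltac solve_C :=
  unfold scal, plus, Cminus, Cplus, Cmult, Copp, RtoC; simpl;
  unfold prod_scal, prod_plus, scal, plus; simpl; unfold mult; simpl;
  apply injective_projections; simpl; field; lra.

Definition shell_reflect (r1 r2 : R) (u : R -> C) (r : R) : C :=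
  @scal R_AbsRing C_R_NormedModule ((r1 + r2 - r) / r) (u (r1 + r2 - r)).

Lemma robin_solution_reflect (r1 r2 : R) (alpha : R * R) (lam : C)
    (u : R -> C) :
  0 < r1 -> r1 < r2 -> robin_solution r1 r2 alpha lam u ->
  robin_solution r1 r2 (reflect_pair r1 r2 alpha) lam (shell_reflect r1 r2 u).
Proof.
  intros H0 H12 (du & ddu & Hdu & Hddu & Hode & Hb1 & Hb2).
  set (s := r1 + r2).
  set (c := fun r => (s - r) / r).
  set (c' := fun r => - s / r ^ 2).
  set (sc := @scal R_AbsRing C_R_NormedModule).
  assert (Hc : forall r, 0 < r -> is_derive c r (c' r)).
  { intros r Hr; unfold c, c'; auto_derive; [lra|field; lra]. }
  assert (Hc' : forall r, 0 < r -> is_derive c' r (2 * s / r ^ 3)).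
  { intros r Hr; unfold c'; auto_derive;
      [rewrite Rmult_1_r; apply Rgt_not_eq, Rmult_lt_0_compat; lra
      |field; lra]. }
  assert (Hnc : forall r, 0 < r -> is_derive (fun t => - c t) r (- c' r)).
  { intros r Hr; apply (is_derive_opp (V := R_NormedModule)), Hc, Hr. }
  (* The derivatives of [v r = c r * u (s - r)], namely [v' = c' u - c u'] and
     [v'' = c'' u - 2 c' u' + c u''] with [u] and its derivatives taken at [s - r]. The second is
     left as a sum of two product-rule outputs. *)
  exists (fun r => plus (sc (c' r) (u (s - r))) (sc (- c r) (du (s - r)))).
  exists (fun r => plus
     (plus (sc (2 * s / r ^ 3) (u (s - r))) (sc (- c' r) (du (s - r))))
     (plus (sc (- c' r) (du (s - r))) (sc (- - c r) (ddu (s - r))))).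
  split; [|split; [|split; [|split]]].
  - intros r Hr.
    assert (Hs : r1 <= s - r <= r2) by (unfold s; lra).
    pose proof (within_Icc_proper r1 r2 r H12 Hr).
    pose proof (within_Icc_proper r1 r2 (s - r) H12 Hs).
    refine (filterdiff_scal_reflect (V := C_R_NormedModule) _ _ s r c (c' r) u (du (s - r))
              (is_filter_lim_within _ r) (is_filter_lim_within _ (s - r))
              (filterlim_reflect_within r1 r2 r) _ (Hdu _ Hs)).
    apply Hc; lra.
  - intros r Hr.
    assert (Hs : r1 < s - r < r2) by (unfold s; lra).
    assert (Hr0 : 0 < r) by lra.
    assert (Hlim : forall x : R, is_filter_lim (locally x) x)
      by (intros x P HP; exact HP).
    apply (is_derive_plus (V := C_R_NormedModule)).
    + refine (filterdiff_scal_reflect (V := C_R_NormedModule) (locally r) (locally (s - r))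
                s r c' _ u (du (s - r)) (Hlim _) (Hlim _)
                (filterlim_reflect s r) (Hc' r Hr0) _).
      apply (is_derive_on_interior r1 r2); [exact Hs|apply Hdu; lra].
    + exact (filterdiff_scal_reflect (V := C_R_NormedModule) (locally r) (locally (s - r))
               s r (fun t => - c t) _ du (ddu (s - r)) (Hlim _) (Hlim _)
               (filterlim_reflect s r) (Hnc r Hr0) (Hddu _ Hs)).
  - intros r Hr.
    assert (Hs : r1 < s - r < r2) by (unfold s; lra).
    assert (Hr0 : 0 < r) by lra.
    assert (Hs0 : 0 < s - r) by lra.
    specialize (Hode _ Hs).
    unfold shell_reflect; fold s sc.
    revert Hode.
    generalize (u (s - r)), (du (s - r)), (ddu (s - r)).
    intros U D A HA.
    (* Eliminating [u''] by the equation at [s - r] cancels the [lam] terms. The coefficient of [u]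
       is then [c'' + 2 c' / r = 0], and that of [u'] is [- 2 c' - 2 c / r - 2 c / (s - r) = 0]. *)
    assert (HA' : A = (- (RtoC (2 / (s - r)) * D) - lam * U)%C)
      by (apply Cminus_eq_0; rewrite <- HA; ring).
    subst A; clear HA; unfold sc, c, c'.
    destruct U, D, lam; solve_C.
  (* The inner condition for the reflection comes from the outer one for [u], and conversely in the
     next case. At both ends [c' / c = - (/ r1 + / r2)], which is the shift in [reflect_pair]. *)
  - unfold shell_reflect; fold s sc; unfold sc, c, c'.
    replace (s - r1) with r2 by (unfold s; ring).
    revert Hb2; generalize (u r2), (du r2); intros U D HD.
    assert (HD' : D = (- (RtoC (snd alpha) * U))%C)
      by (apply Cminus_eq_0; rewrite <- HD; ring).
    subst D; clear HD; unfold s.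
    destruct U, alpha; solve_C.
  - unfold shell_reflect; fold s sc; unfold sc, c, c'.
    replace (s - r2) with r1 by (unfold s; ring).
    revert Hb1; generalize (u r1), (du r1); intros U D HD.
    assert (HD' : D = (RtoC (fst alpha) * U)%C).
    { symmetry; apply Cminus_eq_0; rewrite <- HD; ring. }
    subst D; clear HD; unfold s.
    destruct U, alpha; solve_C.
Qed.

(** A nonzero value of [u] survives at the mirror point, since the factor in [shell_reflect] is
    positive on the shell. *)
Lemma spectrum_reflect (r1 r2 : R) (alpha : R * R) (lam : C) :
  0 < r1 -> r1 < r2 -> spectrum r1 r2 alpha lam ->
  spectrum r1 r2 (reflect_pair r1 r2 alpha) lam.
Proof.
  intros H0 H12 [u [Hu [r [Hr Hne]]]].
  exists (shell_reflect r1 r2 u); split.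
  - apply robin_solution_reflect; assumption.
  - exists (r1 + r2 - r); split; [lra|].
    unfold shell_reflect.
    replace (r1 + r2 - (r1 + r2 - r)) with r by ring.
    rewrite scal_R_Cmult.
    apply Cmult_neq_0; [|exact Hne].
    intros E; apply RtoC_inj in E; revert E.
    apply Rgt_not_eq, Rdiv_lt_0_compat; lra.
Qed.

(** * The reflection on the impedance plane and its consequences *)

Lemma reflect_pair_involutive (r1 r2 : R) (alpha : R * R) :
  reflect_pair r1 r2 (reflect_pair r1 r2 alpha) = alpha.
Proof.
  destruct alpha as [a1 a2]; unfold reflect_pair; simpl.
  apply injective_projections; simpl; ring.
Qed.

Lemma same_spectrum_reflect (r1 r2 : R) (alpha : R * R) :
  0 < r1 -> r1 < r2 -> same_spectrum r1 r2 alpha (reflect_pair r1 r2 alpha).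
Proof.
  intros H0 H12 lam; split; intros H.
  - apply spectrum_reflect; assumption.
  (* Involutivity makes the converse inclusion an instance of the direct one. *)
  - rewrite <- (reflect_pair_involutive r1 r2 alpha).
    apply spectrum_reflect; assumption.
Qed.

(** Both coordinates yield the same linear equation, so the fixed points fill a line. *)
Lemma reflect_pair_fixed (r1 r2 a1 a2 : R) :
  reflect_pair r1 r2 (a1, a2) = (a1, a2) <-> a2 - a1 = / r1 + / r2.
Proof.
  unfold reflect_pair; simpl; split; intros H.
  - injection H; lra.
  - apply injective_projections; simpl; lra.
Qed.

(** The second reflected coordinate is a sum of positive terms, so only the first imposes a
    constraint. *)
Lemma reflect_pair_positive (r1 r2 a1 a2 : R) :
  0 < r1 -> 0 < r2 -> 0 < a1 ->
  positive_quadrant (reflect_pair r1 r2 (a1, a2)) <-> a2 > / r1 + / r2.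
Proof.
  intros H1 H2 Ha.
  apply Rinv_0_lt_compat in H1; apply Rinv_0_lt_compat in H2.
  unfold positive_quadrant, reflect_pair; simpl; lra.
Qed.

Theorem mainTheorem8 :
  (forall r1 r2 : R, 0 < r1 -> r1 < r2 ->
    (forall alpha : R * R,
       same_spectrum r1 r2 alpha (reflect_pair r1 r2 alpha)) /\
    (forall alpha : R * R,
       reflect_pair r1 r2 (reflect_pair r1 r2 alpha) = alpha) /\
    (forall alpha1 alpha2 : R,
       reflect_pair r1 r2 (alpha1, alpha2) <> (alpha1, alpha2) <->
       alpha2 - alpha1 <> / r1 + / r2) /\
    (forall alpha1 alpha2 : R, 0 < alpha1 -> 0 < alpha2 ->
       (positive_quadrant (reflect_pair r1 r2 (alpha1, alpha2)) <->
        alpha2 > / r1 + / r2)) /\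
    (forall alpha1 alpha2 : R, 0 < alpha1 -> alpha2 > / r1 + / r2 ->
       (alpha2 - alpha1 = / r1 + / r2 ->
          reflect_pair r1 r2 (alpha1, alpha2) = (alpha1, alpha2)) /\
       (alpha2 - alpha1 <> / r1 + / r2 ->
          (exists beta : R * R,
             beta <> (alpha1, alpha2) /\ positive_quadrant beta /\
             same_spectrum r1 r2 (alpha1, alpha2) beta) /\
          ~ identified_by_spectrum r1 r2 (alpha1, alpha2) /\
          (forall ks : list C,
             List.Forall (resonance r1 r2 (alpha1, alpha2)) ks ->
             ~ identified_by_resonances r1 r2 (alpha1, alpha2) ks)))) /\
  reflect_pair 1 2 (1, 1) = (- 1 / 2, 5 / 2) /\
  reflect_pair 1 2 (2, 3) = (3 / 2, 7 / 2) /\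
  positive_quadrant (3 / 2, 7 / 2).
Proof.
  split; [|unfold reflect_pair, positive_quadrant; simpl; repeat split;
           try (apply injective_projections; simpl); lra].
  intros r1 r2 H0 H12.
  split; [intros alpha; apply same_spectrum_reflect; assumption|].
  split; [apply reflect_pair_involutive|].
  split; [intros a1 a2; rewrite (reflect_pair_fixed r1 r2 a1 a2); reflexivity|].
  split; [intros a1 a2 Ha1 _; apply reflect_pair_positive; lra|].
  intros a1 a2 Ha1 Ha2; split; [apply reflect_pair_fixed|].
  intros Hne.
  (* The reflected pair alone witnesses all three failures of uniqueness. *)
  set (beta := reflect_pair r1 r2 (a1, a2)).
  assert (Hb : beta <> (a1, a2))
    by (intros E; apply Hne, (reflect_pair_fixed r1 r2), E).
  assert (Hpos : positive_quadrant beta) by (apply reflect_pair_positive; lra).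
  assert (Hsame : same_spectrum r1 r2 (a1, a2) beta)
    by (apply same_spectrum_reflect; assumption).
  split; [exists beta; repeat split; try assumption; apply Hpos || apply Hsame|].
  split.
  - intros Hid; apply Hb, Hid; assumption.
  (* Each listed [k] has [k * k] in the common spectrum, so it is a resonance of [beta] too. *)
  - intros ks Hks Hid; apply Hb, Hid; [assumption|].
    revert Hks; apply Forall_impl; intros k; apply Hsame.
Qed.
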